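(* Let $A_1,\dots,A_m$ be real $n\times n$ matrices and let $l\ge 1$ be an integer. Then $$\rho(A_1^{\otimes l},\dots,A_m^{\otimes l})=\rho(A_1,\dots,A_m)^l.$$
   Context: For a finite set of real square matrices of the same size the joint spectral radius is $$\rho(A_1,\dots,A_m)=\limsup_{k\to+\infty}\ \max_{\sigma\in\{1,\dots,m\}^k}\|A_\sigma\|^{1/k},\qquad A_\sigma=A_{\sigma_k}\cdots A_{\sigma_2}A_{\sigma_1},$$ where $\|\cdot\|$ is any matrix norm (the value does not depend on the choice). $A^{\otimes l}=A\otimes\cdots\otimes A$ ($l$ factors) denotes the $l$-th Kronecker power, where $A\otimes B$ is the Kronecker product (block matrix with blocks $A_{ij}B$). *)

(* Defs.v *)
From HB Require Import structures.
From mathcomp Require Import all_boot all_order all_algebra.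
From mathcomp Require Import mxtens.
From mathcomp Require Import all_classical all_reals all_analysis.

Set Implicit Arguments.
Unset Strict Implicit.
Unset Printing Implicit Defensive.

Import Order.TTheory GRing.Theory Num.Theory.
Local Open Scope ring_scope.

(* Submultiplicativity is deliberately not required, so that this covers both
   submultiplicative matrix norms and arbitrary norms on the space of matrices;
   nonnegativity and N 0 = 0 follow from the three fields. *)
Record is_mxnorm (R : realType) (n : nat) (N : 'M[R]_n -> R) : Prop :=
  IsMxNorm {
    mxnorm_eq0 : forall A, N A = 0 -> A = 0 ;
    mxnormZ : forall (c : R) A, N (c *: A) = `|c| * N A ;
    mxnormD : forall A B, N (A + B) <= N A + N B }.

(* For s = [:: s_1; ...; s_k] this is A_(s_k) *m ... *m A_(s_1): the reversal
   makes the first letter the rightmost factor. *)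
Definition wordmx (R : realType) (n m : nat) (A : 'I_m -> 'M[R]_n)
    (s : seq 'I_m) : 'M[R]_n :=
  \big[mulmx/1%:M]_(i <- rev s) A i.

(* When N is a norm, all the terms are nonnegative, so for 0 < m the default
   value 0 of the iterated max plays no role.  The entry k = 0 does not affect
   the limsup below. *)
Definition jsr_seq (R : realType) (n : nat) (N : 'M[R]_n -> R) (m : nat)
    (A : 'I_m -> 'M[R]_n) (k : nat) : R :=
  \big[Num.max/0]_(s : k.-tuple 'I_m) N (wordmx A s) `^ (k%:R^-1).

(* When N is a norm, jsr_seq N A is bounded (by equivalence of norms in finite
   dimension), so the real-valued limn_sup is the genuine limit superior. *)
Definition jsr (R : realType) (n : nat) (N : 'M[R]_n -> R) (m : nat)
    (A : 'I_m -> 'M[R]_n) : R :=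
  limn_sup (jsr_seq N A).

(* Main.v *)
Require Import Defs.
From mathcomp Require Import all_boot all_order all_algebra.
From mathcomp Require Import mxtens.
From mathcomp Require Import all_classical all_reals all_analysis.

Set Implicit Arguments.
Unset Strict Implicit.
Unset Printing Implicit Defensive.

Import Order.TTheory GRing.Theory Num.Theory.
Import numFieldNormedType.Exports.
Local Open Scope ring_scope.
Local Open Scope classical_set_scope.

(** Write `|A| for the largest absolute value of an entry of A.  This norm is
exactly multiplicative for the Kronecker product, `|A *t B| = `|A| * `|B|,
because the entries of A *t B are precisely the products of an entry of A and
an entry of B.  By the mixed product rule the l-th Kronecker power is
multiplicative for the matrix product, so the word s in the A_i^{(x)l} is the
l-th Kronecker power of the word s in the A_i.  Hence, for this norm, the
sequence whose limit superior is the joint spectral radius of the powers is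
term by term the l-th power of the sequence for A ([jsr_seq_ntens]), and the
limit superior commutes with the l-th power on bounded nonnegative sequences
([limn_sup_expr]).

Passing to arbitrary norms is the analytic part.  On a finite dimensional
space any two norms N and N' satisfy N <= C N' for some C > 0: a norm is
continuous for the entrywise maximum, hence has a positive minimum on the
compact unit sphere ([normmx_le_mxnorm]).  Such a constant changes the k-th
term of the sequence by a factor at most C^(1/k), which tends to 1 and is
therefore invisible to the limit superior of a bounded sequence
([limn_sup_le_mul_cvg1], [jsr_norm_indep]).  Boundedness follows from
`|A *m B| <= n * `|A| * `|B|, which makes the norms of words grow at most
geometrically ([jsr_seq_bounded]). *)

(** * The entrywise maximum norm *)

Lemma normmx_entry_le (R : realType) (p q : nat) (A : 'M[R]_(p, q)) i j :
  `|A i j| <= `|A|.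
Proof.
rewrite [leRHS]/Num.norm/= mx_normrE.
exact: (le_bigmax _ (fun ij : 'I_p * 'I_q => `|A ij.1 ij.2|) (i, j)).
Qed.

Lemma normmx_le (R : realType) (p q : nat) (A : 'M[R]_(p, q)) (c : R) :
  0 <= c -> (forall i j, `|A i j| <= c) -> `|A| <= c.
Proof.
move=> c0 Ac; rewrite [leLHS]/Num.norm/= mx_normrE.
by apply/bigmax_leP; split=> // -[i j] _; exact: Ac.
Qed.

Lemma normmx_mulmx_le (R : realType) (p q r : nat) (A : 'M[R]_(p, q))
    (B : 'M[R]_(q, r)) : `|A *m B| <= q%:R * `|A| * `|B|.
Proof.
apply: normmx_le => [|i j]; first by rewrite !mulr_ge0.
rewrite mxE (le_trans (ler_norm_sum _ _ _))//.
rewrite (@le_trans _ _ (\sum_(k < q) `|A| * `|B|))//.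
  by apply: ler_sum => k _; rewrite normrM ler_pM// normmx_entry_le.
by rewrite sumr_const card_ord -mulrA mulr_natl.
Qed.

(** The entries of the two factors vary independently in a Kronecker product,
so a pair of entries of maximal modulus multiplies to an entry of maximal
modulus: this is where equality, and not just an inequality, comes from. *)
Lemma normmx_tens (R : realType) (p q r s : nat) (A : 'M[R]_(p, q))
    (B : 'M[R]_(r, s)) : `|A *t B| = `|A| * `|B|.
Proof.
apply/eqP; rewrite eq_le; apply/andP; split.
  apply: normmx_le => [|i j]; first by rewrite mulr_ge0.
  by rewrite mxE normrM ler_pM// normmx_entry_le.
have [A0|A0] := eqVneq `|A| 0; first by rewrite A0 mul0r.
have [B0|B0] := eqVneq `|B| 0; first by rewrite B0 mulr0.
have [[i j] /= Aij] := mx_norm_neq0 A0; have [[k l] /= Bkl] := mx_norm_neq0 B0.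
have -> : `|A| = `|A i j| by exact: Aij.
have -> : `|B| = `|B k l| by exact: Bkl.
by rewrite -normrM -tensmxE normmx_entry_le.
Qed.

Lemma normmx_ntens (R : realType) (p q l : nat) (A : 'M[R]_(p, q)) :
  `|A ^t l.+1| = `|A| ^+ l.+1.
Proof.
elim: l => [|l IHl]; first by rewrite ntensmx1 expr1.
by rewrite ntensmxSS normmx_tens IHl -exprS.
Qed.

(** * Kronecker powers of words *)

Lemma tensmx11 (R : pzRingType) (p q : nat) :
  (1%:M : 'M[R]_p) *t (1%:M : 'M[R]_q) = 1%:M.
Proof.
apply/matrixP => i j.
case: (mxtens_indexP i) => i1 i2; case: (mxtens_indexP j) => j1 j2.
rewrite tensmxE !mxE (can_eq (@mxtens_indexK _ _)) xpair_eqE.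
by rewrite -natrM mulnb.
Qed.

(** The exponent is l.+1 because the recursion defining Kronecker powers starts
from A ^t 1 = A rather than from exponent 0. *)
Lemma ntensmx_1 (R : pzRingType) (n l : nat) :
  (1%:M : 'M[R]_n) ^t l.+1 = 1%:M.
Proof. by elim: l => // l IHl; rewrite ntensmxSS IHl tensmx11. Qed.

Lemma ntensmx_mul (R : comPzRingType) (p q r l : nat) (A : 'M[R]_(p, q))
    (B : 'M[R]_(q, r)) : (A *m B) ^t l.+1 = A ^t l.+1 *m B ^t l.+1.
Proof. by elim: l => // l IHl; rewrite !ntensmxSS tensmx_mul -IHl. Qed.

Lemma wordmx_ntens (R : realType) (n m l : nat) (A : 'I_m -> 'M[R]_n)
    (s : seq 'I_m) :
  wordmx (fun i => A i ^t l.+1) s = wordmx A s ^t l.+1.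
Proof.
rewrite /wordmx; elim: (rev s) => [|i r IHr].
  by rewrite !big_nil ntensmx_1.
by rewrite !big_cons IHr ntensmx_mul.
Qed.

(** Nonnegativity makes x |-> x ^+ l.+1 monotone on the values, and a positive
exponent makes it fix the default value 0, so the identity holds also when I
is empty. *)
Lemma bigmax_expr (R : realDomainType) (I : finType) (F : I -> R) (l : nat) :
  (forall i, 0 <= F i) ->
  \big[Num.max/0]_i (F i ^+ l.+1) = (\big[Num.max/0]_i F i) ^+ l.+1.
Proof.
move=> F0; suff [_ ->] : 0 <= \big[Num.max/0]_i F i /\
    \big[Num.max/0]_i (F i ^+ l.+1) = (\big[Num.max/0]_i F i) ^+ l.+1 by [].
apply: (big_ind2 (fun x y => 0 <= x /\ y = x ^+ l.+1)).
- by rewrite expr0n.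
- move=> x _ y _ [x0 ->] [y0 ->]; split; first by rewrite le_max x0.
  have [xy|yx] := leP x y; first by rewrite max_r// lerXn2r.
  by rewrite max_l// lerXn2r// ltW.
- by move=> i _.
Qed.

(** The heart of the theorem: for the entrywise maximum the two sequences are
related exactly, before any limit is taken. *)
Lemma jsr_seq_ntens (R : realType) (n m l : nat) (A : 'I_m -> 'M[R]_n)
    (k : nat) :
  jsr_seq Num.norm (fun i => A i ^t l.+1) k
  = jsr_seq Num.norm A k ^+ l.+1.
Proof.
rewrite /jsr_seq -bigmax_expr => [|s]; last exact: powR_ge0.
apply: eq_bigr => s _; rewrite wordmx_ntens normmx_ntens.
by rewrite -!powR_mulrn ?powR_ge0// powRAC.
Qed.

(** * Limits superior of bounded real sequences *)

Lemma bounded_fun_norm_le (R : realType) (T : Type) (u : T -> R^o) (M : R) :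
  (forall k, `|u k| <= M) -> bounded_fun u.
Proof.
move=> uM; exists M; split; first exact: num_real.
by move=> x Mx k _ /=; rewrite (le_trans (uM k))// ltW.
Qed.

Lemma is_cvg_sups_bounded (R : realType) (u : R^o^nat) :
  bounded_fun u -> cvgn (sups u).
Proof.
move=> bu; apply: nonincreasing_is_cvgn.
  exact/nonincreasing_sups/bounded_fun_has_ubound.
exact: bounded_fun_has_lbound_sups.
Qed.

Lemma limn_sup_le (R : realType) (u v : R^o^nat) :
  bounded_fun u -> bounded_fun v -> (forall k, u k <= v k) ->
  limn_sup u <= limn_sup v.
Proof.
move=> bu bv uv.
apply: ler_lim; [exact: is_cvg_sups_bounded|exact: is_cvg_sups_bounded|].
apply: nearW => n; apply: ge_sup; first by exists (u n), n => /=.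
move=> _ [k /= nk <-]; rewrite (le_trans (uv k))// ub_le_sup//.
  exact/has_ubound_sdrop/bounded_fun_has_ubound.
by exists k.
Qed.

(** Factors tending to 1 do not affect a limit superior: c v differs from v by
(c - 1) v, which tends to 0 because v is bounded. *)
Lemma limn_sup_le_mul_cvg1 (R : realType) (u v : R^o^nat) (c : R^nat) :
  bounded_fun u -> bounded_fun v -> c @ \oo --> (1 : R) ->
  (forall k, u k <= c k * v k) -> limn_sup u <= limn_sup v.
Proof.
move=> bu bv c1 ucv; pose w : R^o^nat := fun k => (c k - 1) * v k.
have w0 : w @ \oo --> (0 : R^o).
  have [M [_ vM]] := bv.
  have {}vM k : `|v k| <= `|M| + 1.
    by apply: (vM (`|M| + 1)) => //; rewrite (le_lt_trans (ler_norm _))// ltrDl.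
  apply: norm_cvg0.
  apply: (@squeeze_cvgr _ _ _ _ (cst 0) (fun k => `|c k - 1| * (`|M| + 1))).
  - by apply: nearW => k; rewrite normr_ge0/= normrM ler_wpM2l.
  - exact: cvg_cst.
  - rewrite -(mul0r (`|M| + 1)); apply: cvgM; last exact: cvg_cst.
    by apply/norm_cvg0P/subr_cvg0.
have bw : bounded_fun w by apply: cvg_seq_bounded; apply/cvg_ex; exists 0.
have -> : limn_sup v = limn_sup v + limn_sup w.
  by rewrite (cvg_limn_inf_sup w0).2 addr0.
apply: (le_trans _ (le_limn_supD bv bw)).
apply: limn_sup_le => //; first exact: bounded_funD.
by move=> k /=; rewrite /w mulrBl mul1r addrC subrK.
Qed.

(** The power commutes with suprema of nonnegative values because it is
increasing with an increasing inverse: the bound from below is obtained by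
taking (l+1)-th roots of an upper bound t of the powers. *)
Lemma sups_expr (R : realType) (u : R^nat) (l n : nat) :
  (forall k, 0 <= u k) -> has_ubound (range u) ->
  sups (fun k => u k ^+ l.+1) n = sups u n ^+ l.+1.
Proof.
move=> u0 ubu.
have ub_le (k : nat) : (n <= k)%N -> u k <= sups u n.
  by move=> nk; apply: ub_le_sup; [exact: has_ubound_sdrop|exists k].
have ubX (k : nat) : (n <= k)%N -> u k ^+ l.+1 <= sups u n ^+ l.+1.
  by move=> nk; rewrite lerXn2r ?nnegrE ?(le_trans (u0 k) (ub_le k nk))// ub_le.
apply/eqP; rewrite eq_le; apply/andP; split.
  apply: ge_sup; first by exists (u n ^+ l.+1), n => /=.
  by move=> _ [k /= nk <-]; exact: ubX.
set t := (X in _ <= X).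
have le_t (k : nat) : (n <= k)%N -> u k ^+ l.+1 <= t.
  move=> nk; apply: ub_le_sup; last by exists k.
  by exists (sups u n ^+ l.+1) => _ [j /= nj <-]; exact: ubX.
have t0 : 0 <= t by rewrite (le_trans _ (le_t n _))// exprn_ge0.
have rootK (x : R) : 0 <= x -> (x `^ l.+1%:R^-1) ^+ l.+1 = x.
  by move=> x0; rewrite -powR_mulrn ?powR_ge0// -powRrM mulVf ?powRr1//.
rewrite -(rootK t)// lerXn2r ?nnegrE ?powR_ge0//.
  by rewrite (le_trans (u0 n))// ub_le.
apply: ge_sup; first by exists (u n), n => /=.
move=> _ [k /= nk <-].
by rewrite -(@ler_pXn2r _ l.+1) ?nnegrE ?powR_ge0// rootK// le_t.
Qed.

Lemma limn_sup_expr (R : realType) (u : R^o^nat) (l : nat) :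
  (forall k, 0 <= u k) -> bounded_fun u ->
  limn_sup (fun k => u k ^+ l.+1) = limn_sup u ^+ l.+1.
Proof.
move=> u0 bu; apply/cvg_lim => //.
have -> : sups (fun k => u k ^+ l.+1) = (fun n => sups u n ^+ l.+1).
  by apply/funext => n; rewrite sups_expr//; exact: bounded_fun_has_ubound.
apply: (@cvg_comp _ _ _ (sups u) (fun x : R => x ^+ l.+1) _ _ _
  (is_cvg_sups_bounded bu)).
exact: exprn_continuous.
Qed.

Lemma cvg_powR_inv (R : realType) (C : R) : 0 < C ->
  (fun k : nat => C `^ k%:R^-1) @ \oo --> (1 : R).
Proof.
move=> C0.
(* The shift discards k = 0, so that the exponents are the harmonic sequence. *)
rewrite -(@cvg_shiftS R (fun k : nat => C `^ k%:R^-1)).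
have h0 : (fun k : nat => harmonic k * ln C) @ \oo --> (0 : R).
  rewrite -(mul0r (ln C)).
  by apply: cvgM; [exact: cvg_harmonic|exact: cvg_cst].
have -> : [sequence C `^ k.+1%:R^-1]_k = expR \o (fun k => harmonic k * ln C).
  by apply/funext => k; rewrite /= /powR gt_eqF.
have : expR (harmonic k * ln C) @[k --> \oo] --> expR (0 : R).
  by apply: continuous_cvg h0; exact: continuous_expR.
by rewrite expR0.
Qed.

(** * Equivalence of matrix norms *)

Lemma normmx_is_mxnorm (R : realType) (n : nat) :
  is_mxnorm (Num.norm : 'M[R]_n -> R).
Proof.
by split=> [A|c A|A B]; [exact: normr0_eq0|exact: mx_normZ|exact: ler_normD].
Qed.

Lemma mxnorm0 (R : realType) (n : nat) (N : 'M[R]_n -> R) :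
  is_mxnorm N -> N 0 = 0.
Proof. by move=> hN; rewrite -(scale0r 0) (mxnormZ hN) normr0 mul0r. Qed.

Lemma mxnormN (R : realType) (n : nat) (N : 'M[R]_n -> R) (A : 'M[R]_n) :
  is_mxnorm N -> N (- A) = N A.
Proof. by move=> hN; rewrite -scaleN1r (mxnormZ hN) normrN1 mul1r. Qed.

Lemma mxnorm_ge0 (R : realType) (n : nat) (N : 'M[R]_n -> R) (A : 'M[R]_n) :
  is_mxnorm N -> 0 <= N A.
Proof.
move=> hN; have := mxnormD hN A (- A).
by rewrite subrr (mxnorm0 hN) (mxnormN _ hN) -mulr2n pmulrn_lge0.
Qed.

Lemma mxnorm_sum (R : realType) (n : nat) (N : 'M[R]_n -> R)
    (I : Type) (r : seq I) (F : I -> 'M[R]_n) : is_mxnorm N ->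
  N (\sum_(i <- r) F i) <= \sum_(i <- r) N (F i).
Proof.
move=> hN.
elim/big_ind2: _ => [|A a B b Aa Bb|//]; first by rewrite (mxnorm0 hN).
by rewrite (le_trans (mxnormD hN a b))// lerD.
Qed.

Lemma mxnorm_le_normmx (R : realType) (n : nat) (N : 'M[R]_n -> R) :
  is_mxnorm N -> exists2 C : R, 0 < C & forall A, N A <= C * `|A|.
Proof.
move=> hN.
exists (1 + \sum_i \sum_j N (delta_mx i j)).
  by rewrite ltr_pwDl// sumr_ge0// => i _; rewrite sumr_ge0// => j _;
    exact: mxnorm_ge0.
move=> A; rewrite mulrDl mul1r ler_wpDl// {1}(matrix_sum_delta A).
rewrite (le_trans (mxnorm_sum _ _ hN))// mulr_suml; apply: ler_sum => i _.
rewrite (le_trans (mxnorm_sum _ _ hN))// mulr_suml; apply: ler_sum => j _.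
by rewrite (mxnormZ hN) mulrC ler_wpM2l ?(mxnorm_ge0 _ hN)// normmx_entry_le.
Qed.

(** N is Lipschitz for the entrywise maximum, by the triangle inequality and
[mxnorm_le_normmx].  It is transported along [vec_mx] because the sphere on
which it is minimized below is taken, for compactness, in row vectors. *)
Lemma mxnorm_continuous (R : realType) (n : nat) (N : 'M[R]_n -> R) :
  is_mxnorm N -> continuous (fun v : 'rV[R]_(n * n) => N (vec_mx v)).
Proof.
move=> hN; have [C C0 NC] := mxnorm_le_normmx hN.
have vec_le (v : 'rV[R]_(n * n)) : `|vec_mx v : 'M[R]_n| <= `|v|.
  by apply: normmx_le => // i j; rewrite mxE normmx_entry_le.
move=> v; apply: (proj2 (@cvgrPdist_le R R^o _ (nbhs v) _ _ _)) => e e0; near=> w.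
have sub a b : N (vec_mx a) <= N (vec_mx b) + N (vec_mx (a - b)).
  by apply: le_trans (mxnormD hN _ _); rewrite -linearD/= addrC subrK.
have lip : `|N (vec_mx v) - N (vec_mx w)| <= N (vec_mx (v - w)).
  rewrite ler_distl lerBlDr sub andbT.
  by rewrite (le_trans (sub w v))// -opprB linearN (mxnormN _ hN).
rewrite (le_trans lip)// (le_trans (NC _))//.
rewrite -ler_pdivlMl// (le_trans (vec_le _))//.
near: w; apply: cvgr_dist_le; first exact: cvg_id.
by rewrite mulr_gt0// invr_gt0.
Unshelve. all: by end_near. Qed.

(** The constant is the inverse of the minimum of N on the unit sphere of the
entrywise maximum, which is positive since N vanishes only at 0. *)
Lemma normmx_le_mxnorm (R : realType) (n : nat) (N : 'M[R]_n -> R) :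
  is_mxnorm N -> exists2 C : R, 0 < C & forall A, `|A| <= C * N A.
Proof.
move=> hN; have vec_norm (A : 'M[R]_n) : `|A| <= `|mxvec A|.
  by apply: normmx_le => // i j; rewrite -mxvecE normmx_entry_le.
pose S := [set v : 'rV[R]_(n * n) | `|v| = 1].
(* The sphere is empty exactly when n = 0, and then every matrix is 0. *)
have [[v0 Sv0]|S0] := pselect (S !=set0); last first.
  exists 1 => // A; have [->|A0] := eqVneq A 0.
    by rewrite normr0 (mxnorm0 hN) mulr0.
  have vA0 : `|mxvec A| != 0.
    by rewrite normr_eq0 mxvec_eq0.
  exfalso; apply: S0; exists (`|mxvec A|^-1 *: mxvec A).
  by rewrite /S/= mx_normZ ger0_norm ?invr_ge0// mulVf.
have cS : compact S.
  apply: bounded_closed_compact.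
    exists 1; split=> // x x1 v Sv /=.
    by rewrite Sv ltW.
  apply: (@closed_comp _ _ (fun v : 'rV[R]_(n * n) => `|v|) [set 1]).
    by move=> v _; exact: norm_continuous.
  exact: closed_eq.
have [v Sv vmin] := EVT_min_rV (ex_intro _ v0 Sv0) cS
  (continuous_subspaceT (mxnorm_continuous hN)).
have Nv0 : 0 < N (vec_mx v).
  rewrite lt_neqAle (mxnorm_ge0 _ hN) andbT eq_sym; apply/eqP => /(mxnorm_eq0 hN) v0'.
  move: Sv; rewrite inE /S/= -(vec_mxK v) v0' linear0 normr0 => /esym/eqP.
  by rewrite oner_eq0.
exists (N (vec_mx v))^-1; first by rewrite invr_gt0.
move=> A; have [->|A0] := eqVneq A 0.
  by rewrite normr0 (mxnorm0 hN) mulr0.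
have vA0 : 0 < `|mxvec A| by rewrite normr_gt0 mxvec_eq0.
rewrite (le_trans (vec_norm A))// mulrC ler_pdivlMr//.
have := vmin (`|mxvec A|^-1 *: mxvec A).
rewrite linearZ/= (mxnormZ hN) mxvecK normrV ?unitfE ?gt_eqF// normr_id.
rewrite ler_pdivlMl//; apply.
by rewrite inE /S/= mx_normZ normrV ?unitfE ?gt_eqF// normr_id mulVf// gt_eqF.
Qed.

Lemma mxnorm_le_mxnorm (R : realType) (n : nat) (N N' : 'M[R]_n -> R) :
  is_mxnorm N -> is_mxnorm N' ->
  exists2 C : R, 0 < C & forall A, N A <= C * N' A.
Proof.
move=> hN hN'; have [C C0 NC] := mxnorm_le_normmx hN.
have [D D0 ND] := normmx_le_mxnorm hN'.
exists (C * D) => [|A]; first by rewrite mulr_gt0.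
by rewrite (le_trans (NC A))// -mulrA ler_pM2l.
Qed.

(** * The joint spectral radius does not depend on the norm *)

Lemma jsr_seq_ge0 (R : realType) (n m : nat) (N : 'M[R]_n -> R)
  (A : 'I_m -> 'M[R]_n) (k : nat) : 0 <= jsr_seq N A k.
Proof. exact: bigmax_ge_id. Qed.

Lemma wordmx_normmx_le (R : realType) (n m : nat) (A : 'I_m -> 'M[R]_n) :
  exists2 K : R, 1 <= K & forall s, `|wordmx A s| <= K ^+ size s.
Proof.
(* The factor n makes up for the entrywise maximum not being
   submultiplicative; the summand 1 gives K >= 1. *)
exists (1 + n%:R * \sum_i `|A i|) => [|s].
  by rewrite lerDl mulr_ge0// sumr_ge0.
rewrite -size_rev /wordmx; elim: (rev s) => [|i r IHr].
  rewrite big_nil expr0; apply: normmx_le => // i j.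
  by rewrite mxE; case: eqP => _; rewrite ?mulr1n ?mulr0n ?normr1 ?normr0.
rewrite big_cons exprS (le_trans (normmx_mulmx_le _ _))//.
apply: ler_pM => //.
rewrite ler_wpDl// ler_wpM2l//.
by rewrite (bigD1 i)//= lerDl sumr_ge0.
Qed.

(** An inequality rather than an equality because of k = 0, where 0^-1 = 0 makes
the left-hand side 1; this is why x is at least 1. *)
Lemma powRX_inv_le (R : realType) (x : R) (k : nat) :
  1 <= x -> (x ^+ k) `^ k%:R^-1 <= x.
Proof.
move=> x1; have x0 : 0 <= x by exact: le_trans x1.
case: k => [|k]; first by rewrite invr0 powRr0.
by rewrite -powR_mulrn// -powRrM mulfV ?pnatr_eq0// powRr1.
Qed.

Lemma jsr_seq_le_mul (R : realType) (n m : nat) (N N' : 'M[R]_n -> R)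
    (A : 'I_m -> 'M[R]_n) (C : R) (k : nat) : is_mxnorm N -> is_mxnorm N' ->
  0 < C -> (forall X, N X <= C * N' X) ->
  jsr_seq N A k <= C `^ k%:R^-1 * jsr_seq N' A k.
Proof.
move=> hN hN' C0 NC; apply/bigmax_leP; split=> [|s _].
  by rewrite mulr_ge0 ?powR_ge0 ?jsr_seq_ge0.
have k0 : 0 <= k%:R^-1 :> R by rewrite invr_ge0.
apply: (@le_trans _ _ ((C * N' (wordmx A s)) `^ k%:R^-1)).
  rewrite ge0_ler_powR ?nnegrE ?mulr_ge0 ?(mxnorm_ge0 _ hN) ?(mxnorm_ge0 _ hN')//.
  exact: ltW.
rewrite powRM ?(mxnorm_ge0 _ hN') ?(ltW C0)// ler_wpM2l ?powR_ge0//.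
exact: (le_bigmax _ (fun s : k.-tuple 'I_m => N' (wordmx A s) `^ k%:R^-1)).
Qed.

(** Words of length k have norm at most K ^+ k, so k-th roots are at most K, up
to the factor C^(1/k) that accounts for the change of norm and converges. *)
Lemma jsr_seq_bounded (R : realType) (n m : nat) (N : 'M[R]_n -> R)
    (A : 'I_m -> 'M[R]_n) : is_mxnorm N ->
  bounded_fun (jsr_seq N A : R^o^nat).
Proof.
move=> hN; have [C C0 NC] := mxnorm_le_normmx hN.
have [K K1 AK] := wordmx_normmx_le A.
have [M [_ cM]] := cvg_seq_bounded (cvgP _ (cvg_powR_inv C0)).
have {}cM k : C `^ k%:R^-1 <= `|M| + 1.
  rewrite -[leLHS]ger0_norm ?powR_ge0//; apply: cM => //.
  by rewrite (le_lt_trans (ler_norm _))// ltrDl.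
have K0 : 0 <= K by exact: le_trans K1.
apply: (@bounded_fun_norm_le _ _ _ ((`|M| + 1) * K)) => k.
rewrite ger0_norm ?jsr_seq_ge0//.
rewrite (le_trans (jsr_seq_le_mul _ _ hN (@normmx_is_mxnorm R n) C0 NC))//.
apply: ler_pM; rewrite ?powR_ge0 ?jsr_seq_ge0//.
apply/bigmax_leP; split=> // s _.
apply: le_trans (powRX_inv_le k K1).
rewrite ge0_ler_powR ?nnegrE ?invr_ge0 ?exprn_ge0//.
by rewrite (le_trans (AK s))// size_tuple.
Qed.

Lemma jsr_norm_indep (R : realType) (n m : nat) (N N' : 'M[R]_n -> R)
    (A : 'I_m -> 'M[R]_n) : is_mxnorm N -> is_mxnorm N' ->
  jsr N A = jsr N' A.
Proof.
move=> hN hN'; apply/eqP; rewrite eq_le; apply/andP.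
by split; [have [C C0 NC] := mxnorm_le_mxnorm hN hN'
          |have [C C0 NC] := mxnorm_le_mxnorm hN' hN];
  apply: (limn_sup_le_mul_cvg1 (jsr_seq_bounded _ _) (jsr_seq_bounded _ _)
    (cvg_powR_inv C0)) => // k; exact: jsr_seq_le_mul.
Qed.

(** * Joint spectral radius of Kronecker powers *)

Theorem theorem2 (R : realType) (n m l : nat) (A : 'I_m -> 'M[R]_n)
    (N : 'M[R]_n -> R) (Nl : 'M[R]_(n ^ l) -> R)
    (hm : (0 < m)%N) (hl : (1 <= l)%N)
    (hN : is_mxnorm N) (hNl : is_mxnorm Nl) :
  jsr Nl (fun i => A i ^t l) = jsr N A ^+ l.
Proof.
case: l hl Nl hNl => // l _ Nl hNl.
rewrite (jsr_norm_indep _ hNl (@normmx_is_mxnorm R _)).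
rewrite (jsr_norm_indep _ hN (@normmx_is_mxnorm R n)).
rewrite /jsr -limn_sup_expr.
- by congr (limn_sup _); apply/funext => k; exact: jsr_seq_ntens.
- by move=> k; exact: jsr_seq_ge0.
- exact/jsr_seq_bounded/normmx_is_mxnorm.
Qed.
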